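(* Let $k$ be a commutative ring and let $(\mathcal C,\mu^c,e^c)$ be a cooperad with comultiplication in $k$-modules. On $\mathcal C(n)$ set $$d_0:=(\mu^c\otimes\mathrm{id})\circ\Delta_{2,n-1,2},\qquad d_i:=(\mathrm{id}\otimes\mu^c)\circ\Delta_{n-1,2,i}\ (1\le i\le n-1),\qquad d_n:=(\mu^c\otimes\mathrm{id})\circ\Delta_{2,n-1,1}$$ for $n\ge1$ (maps $\mathcal C(n)\to\mathcal C(n-1)$), and $$s_i:=(\mathrm{id}\otimes e^c)\circ\Delta_{n+1,0,i+1}\colon\mathcal C(n)\to\mathcal C(n+1),\qquad 0\le i\le n,$$ for $n\ge0$. Then $(\mathcal C,d_\bullet,s_\bullet)$ is a simplicial $k$-module, with $\mathcal C(n)$ in simplicial degree $n$, face maps $d_i$ and degeneracy maps $s_i$. In particular, $d=\sum_{i=0}^n(-1)^id_i\colon\mathcal C(n)\to\mathcal C(n-1)$ is a differential, i.e. $d^2=0$.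
   Context: Tensor products are over $k$, and $k\otimes M\cong M\cong M\otimes k$ is used implicitly. A planar counital cooperad is a sequence $\mathcal C=\{\mathcal C(n)\}_{n\ge0}$ of $k$-modules with $k$-linear maps $\epsilon\colon\mathcal C(1)\to k$ and $\Delta_{p,q,i}\colon\mathcal C(p+q-1)\to\mathcal C(p)\otimes\mathcal C(q)$ for $p\ge1$, $q\ge0$, $1\le i\le p$ (and $\Delta_{0,q,i}:=0$), such that $(\epsilon\otimes\mathrm{id})\circ\Delta_{1,n,1}=\mathrm{id}_{\mathcal C(n)}$, $(\mathrm{id}\otimes\epsilon)\circ\Delta_{n,1,i}=\mathrm{id}_{\mathcal C(n)}$ for $1\le i\le n$, and for all $p\ge 1$, $q,r\ge0$, $1\le i\le p$, $1\le j\le p+q-1$: $$(\Delta_{p,q,i}\otimes\mathrm{id})\circ\Delta_{p+q-1,r,j}=\begin{cases}(\mathrm{id}\otimes\sigma)\circ(\Delta_{p,r,j-q+1}\otimes\mathrm{id})\circ\Delta_{p+r-1,q,i}& i\le j-q,\\(\mathrm{id}\otimes\Delta_{q,r,j-i+1})\circ\Delta_{p,q+r-1,i}& j-q<i\le j,\\(\mathrm{id}\otimes\sigma)\circ(\Delta_{p,r,j}\otimes\mathrm{id})\circ\Delta_{p+r-1,q,i+r-1}& j<i\le p,\end{cases}$$ where $\sigma(a\otimes b)=b\otimes a$. A cooperad with comultiplication is a planar counital cooperad $\mathcal C$ with a morphism of counital cooperads to the linear dual of the unital associative operad; equivalently, with $k$-linear maps $\mu^c\colon\mathcal C(2)\to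 k$ and $e^c\colon\mathcal C(0)\to k$ such that $(\mu^c\otimes\mu^c)\circ\Delta_{2,2,1}=(\mu^c\otimes\mu^c)\circ\Delta_{2,2,2}$ and $(\mu^c\otimes e^c)\circ\Delta_{2,0,1}=(\mu^c\otimes e^c)\circ\Delta_{2,0,2}=\epsilon$. *)

(* Defs.v *)
From HB Require Import structures.
From mathcomp Require Import all_boot all_algebra.
From mathcomp Require Import boolp.

Set Implicit Arguments.
Unset Strict Implicit.
Unset Printing Implicit Defensive.

Import GRing.Theory.
Local Open Scope ring_scope.
Local Open Scope quotient_scope.

(* Modules over a [comPzRingType]: the base ring may be the zero ring, which
   is why the [{bilinear _ -> _ -> _}] of sesquilinear.v (over a [nzRingType])
   is not used. *)

Definition bilinear_map (k : comPzRingType) (M N P : lmodType k)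
    (f : M -> N -> P) : Prop :=
  (forall n, linear (f^~ n)) /\ (forall m, linear (f m)).

Section TensorProduct.
Variables (k : comPzRingType) (M N : lmodType k).

(* A finite sequence of pairs [(m, n)] stands for the formal sum of the
   [m (x) n]; scalars and signs are absorbed in the first component. *)
Inductive tens_eq : seq (M * N) -> seq (M * N) -> Prop :=
| tens_eq_refl s : tens_eq s s
| tens_eq_sym s t : tens_eq s t -> tens_eq t s
| tens_eq_trans s t u : tens_eq s t -> tens_eq t u -> tens_eq s u
| tens_eq_cat s s' t t' :
    tens_eq s s' -> tens_eq t t' -> tens_eq (s ++ t) (s' ++ t')
| tens_eq_catC s t : tens_eq (s ++ t) (t ++ s)
| tens_eq_0l n : tens_eq [:: (0, n)] [::]
| tens_eq_Dl m m' n : tens_eq [:: (m + m', n)] [:: (m, n); (m', n)]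
| tens_eq_Dr m n n' : tens_eq [:: (m, n + n')] [:: (m, n); (m, n')]
| tens_eq_Z a m n : tens_eq [:: (a *: m, n)] [:: (m, a *: n)].

Definition tens_eqb (s t : seq (M * N)) : bool := `[< tens_eq s t >].

Lemma tens_eqb_equiv : equiv_class_of tens_eqb.
Proof.
split=> [s|s t|t s u].
- by apply/asboolP; exact: tens_eq_refl.
- by apply/asboolP/asboolP => /tens_eq_sym.
- by move=> /asboolP st /asboolP tu; apply/asboolP; exact: tens_eq_trans tu.
Qed.

Canonical tens_equiv := EquivRelPack tens_eqb_equiv.

Definition tensor : Type := {eq_quot tens_equiv}.

HB.instance Definition _ := Choice.on tensor.
HB.instance Definition _ := EqQuotient.on tensor.

Lemma tens_piE s t : (\pi_tensor s = \pi_tensor t) <-> tens_eq s t.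
Proof. by split=> [/eqmodP/asboolP //|st]; apply/eqmodP/asboolP. Qed.

Lemma tens_repr s : tens_eq (repr (\pi_tensor s)) s.
Proof. by apply/tens_piE; rewrite reprK. Qed.

Definition tens_scale_seq (a : k) (s : seq (M * N)) :=
  [seq (a *: x.1, x.2) | x <- s].

Lemma tens_scale_seq_eq a s t :
  tens_eq s t -> tens_eq (tens_scale_seq a s) (tens_scale_seq a t).
Proof.
elim=> {s t}.
- by move=> s; exact: tens_eq_refl.
- by move=> s t _; exact: tens_eq_sym.
- by move=> s t u _ st _; exact: tens_eq_trans.
- by move=> s s' t t' _ h1 _ h2; rewrite /tens_scale_seq !map_cat; exact: tens_eq_cat.
- by move=> s t; rewrite /tens_scale_seq !map_cat; exact: tens_eq_catC.
- by move=> n /=; rewrite scaler0; exact: tens_eq_0l.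
- by move=> m m' n /=; rewrite scalerDr; exact: tens_eq_Dl.
- by move=> m n n' /=; exact: tens_eq_Dr.
- move=> b m n /=; rewrite scalerA mulrC -scalerA; exact: tens_eq_Z.
Qed.

Definition tens_zero : tensor := \pi_tensor [::].
Definition tens_add (s t : tensor) : tensor := \pi_tensor (repr s ++ repr t).
Definition tens_scale (a : k) (s : tensor) : tensor :=
  \pi_tensor (tens_scale_seq a (repr s)).
Definition tens_opp : tensor -> tensor := tens_scale (-1).

Lemma tens_add_pi s t :
  tens_add (\pi_tensor s) (\pi_tensor t) = \pi_tensor (s ++ t).
Proof. by apply/tens_piE/tens_eq_cat; exact: tens_repr. Qed.

Lemma tens_scale_pi a s :
  tens_scale a (\pi_tensor s) = \pi_tensor (tens_scale_seq a s).
Proof. by apply/tens_piE/tens_scale_seq_eq; exact: tens_repr. Qed.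

Lemma tens_ind (P : tensor -> Prop) : (forall s, P (\pi_tensor s)) -> forall v, P v.
Proof. by move=> Ppi v; rewrite -[v]reprK. Qed.

Lemma tens_addA : associative tens_add.
Proof.
elim/tens_ind=> s; elim/tens_ind=> t; elim/tens_ind=> u.
by rewrite (tens_add_pi t u) (tens_add_pi s t) !(tens_add_pi, catA).
Qed.

Lemma tens_addC : commutative tens_add.
Proof.
elim/tens_ind=> s; elim/tens_ind=> t; rewrite !tens_add_pi.
by apply/tens_piE/tens_eq_catC.
Qed.

Lemma tens_add0 : left_id tens_zero tens_add.
Proof. by elim/tens_ind=> s; rewrite tens_add_pi. Qed.

Lemma tens_scaleDl (v : tensor) a b :
  tens_scale (a + b) v = tens_add (tens_scale a v) (tens_scale b v).
Proof.
elim/tens_ind: v => s; rewrite !tens_scale_pi tens_add_pi.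
elim: s => [//|[m n] s IHs] /=.
transitivity (tens_add (\pi_tensor [:: (a *: m, n); (b *: m, n)])
                       (\pi_tensor (tens_scale_seq (a + b) s))).
  rewrite tens_add_pi; apply/tens_piE.
  rewrite -cat1s; apply: tens_eq_cat; last exact: tens_eq_refl.
  by rewrite scalerDl; exact: tens_eq_Dl.
rewrite IHs tens_add_pi; apply/tens_piE => /=.
apply: (@tens_eq_cat [:: (a *: m, n)] [:: (a *: m, n)]); first exact: tens_eq_refl.
rewrite -cat1s catA -[_ ++ _ :: _]cat_rcons -cats1.
by apply: tens_eq_cat (tens_eq_catC _ _) (tens_eq_refl _).
Qed.

Lemma tens_scale0 (v : tensor) : tens_scale 0 v = tens_zero.
Proof.
elim/tens_ind: v => s; rewrite tens_scale_pi; apply/tens_piE.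
elim: s => [|[m n] s IHs] /=; first exact: tens_eq_refl.
rewrite scale0r -cat1s -[X in tens_eq _ X]cat0s.
exact: tens_eq_cat (tens_eq_0l _) IHs.
Qed.

Lemma tens_scale1 : left_id 1 tens_scale.
Proof.
elim/tens_ind=> s; rewrite tens_scale_pi /tens_scale_seq map_id_in //.
by move=> [m n] _ /=; rewrite scale1r.
Qed.

Lemma tens_addN : left_inverse tens_zero tens_opp tens_add.
Proof.
move=> v; rewrite -{2}[v]tens_scale1 -tens_scaleDl addNr; exact: tens_scale0.
Qed.

Lemma tens_scaleA a b v : tens_scale a (tens_scale b v) = tens_scale (a * b) v.
Proof.
elim/tens_ind: v => s; rewrite !tens_scale_pi /tens_scale_seq -map_comp.
by congr (\pi _); apply: eq_map => -[m n] /=; rewrite scalerA.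
Qed.

Lemma tens_scaleDr : right_distributive tens_scale tens_add.
Proof.
move=> a; elim/tens_ind=> s; elim/tens_ind=> t.
by rewrite tens_add_pi !tens_scale_pi tens_add_pi /tens_scale_seq map_cat.
Qed.

HB.instance Definition _ :=
  GRing.isZmodule.Build tensor tens_addA tens_addC tens_add0 tens_addN.
HB.instance Definition _ :=
  GRing.Zmodule_isLmodule.Build k tensor
    tens_scaleA tens_scale1 tens_scaleDr tens_scaleDl.

Definition tens (m : M) (n : N) : tensor := \pi_tensor [:: (m, n)].

Lemma tens_bilinear : bilinear_map tens.
Proof.
split=> [n a m m'|m a n n']; apply/esym; rewrite /GRing.scale /GRing.add /=.
- rewrite tens_scale_pi tens_add_pi.
  by apply/tens_piE/tens_eq_sym; exact: tens_eq_Dl.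
- rewrite tens_scale_pi tens_add_pi; apply/tens_piE/tens_eq_sym.
  apply: tens_eq_trans (tens_eq_Dr _ _ _) _.
  by apply: (@tens_eq_cat [:: _] [:: _] [:: _] [:: _]);
    [apply/tens_eq_sym/tens_eq_Z|exact: tens_eq_refl].
Qed.

Lemma tens_piS s : \pi_tensor s = \sum_(x <- s) tens x.1 x.2.
Proof.
elim: s => [|[m n] s IHs]; first by rewrite big_nil.
by rewrite big_cons -IHs /GRing.add /= tens_add_pi.
Qed.

Lemma tens_sum (v : tensor) : exists s, v = \sum_(x <- s) tens x.1 x.2.
Proof. by exists (repr v); rewrite -tens_piS reprK. Qed.

Section UniversalProperty.
Variables (P : lmodType k) (f : M -> N -> P) (fB : bilinear_map f).

Definition tens_lift_fun (v : tensor) : P := \sum_(x <- repr v) f x.1 x.2.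

Lemma tens_lift_fun_eq s t : tens_eq s t ->
  \sum_(x <- s) f x.1 x.2 = \sum_(x <- t) f x.1 x.2.
Proof.
have [fl fr] := fB.
pose F n := HB.pack_for {linear M -> P} (f^~ n)
  (GRing.isLinear.Build _ _ _ _ _ (fl n)).
pose G m := HB.pack_for {linear N -> P} (f m)
  (GRing.isLinear.Build _ _ _ _ _ (fr m)).
elim=> {s t}.
- by [].
- by move=> s t _ ->.
- by move=> s t u _ -> _ ->.
- by move=> s s' t t' _ h1 _ h2; rewrite !big_cat /= h1 h2.
- by move=> s t; rewrite !big_cat /= addrC.
- by move=> n; rewrite big_seq1 big_nil /=; exact: (raddf0 (F n)).
- move=> m m' n; rewrite !(big_cons, big_nil) /= !addr0; exact: (raddfD (F n)).
- move=> m n n'; rewrite !(big_cons, big_nil) /= !addr0; exact: (raddfD (G m)).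
- move=> a m n; rewrite !big_seq1 /=.
  exact: etrans (linearZ_LR (F n) a m) (esym (linearZ_LR (G m) a n)).
Qed.

Lemma tens_lift_pi s :
  tens_lift_fun (\pi_tensor s) = \sum_(x <- s) f x.1 x.2.
Proof. exact: tens_lift_fun_eq (tens_repr s). Qed.

Lemma tens_lift_linear : linear tens_lift_fun.
Proof.
move=> a; elim/tens_ind=> s; elim/tens_ind=> t.
rewrite {1}/GRing.scale {1}/GRing.add /= tens_scale_pi tens_add_pi.
rewrite !tens_lift_pi big_cat big_map scaler_sumr /=; congr (_ + _).
apply: eq_bigr => -[m n] _ /=.
pose F := HB.pack_for {linear M -> P} (f^~ n)
  (GRing.isLinear.Build _ _ _ _ _ (fB.1 n)).
exact: (linearZ_LR F a m).
Qed.

Definition tens_lift : {linear tensor -> P} :=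
  HB.pack_for {linear tensor -> P} tens_lift_fun
    (GRing.isLinear.Build _ _ _ _ _ tens_lift_linear).

Lemma tens_liftE m n : tens_lift (tens m n) = f m n.
Proof. by rewrite /= tens_lift_pi big_seq1. Qed.

End UniversalProperty.

Lemma tens_ext (P : lmodType k) (g h : {linear tensor -> P}) :
  (forall m n, g (tens m n) = h (tens m n)) -> g =1 h.
Proof.
move=> gh v; have [s ->] := tens_sum v.
by rewrite !raddf_sum; apply: eq_bigr => x _; exact: gh.
Qed.

End TensorProduct.

Notation "M ⊗ N" := (tensor M N) (at level 40, left associativity) : type_scope.

Section TensorFunctoriality.
Variable k : comPzRingType.
Implicit Types A B C M : lmodType k.

Lemma tens_map_bilinear A A' B B' (f : {linear A -> A'}) (g : {linear B -> B'}) :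
  bilinear_map (fun a b => tens (f a) (g b)).
Proof.
have [hl hr] := tens_bilinear A' B'.
split=> [b c a a'|a c b b'] /=; rewrite linearP; [exact: hl|exact: hr].
Qed.

Definition tens_map A A' B B' (f : {linear A -> A'}) (g : {linear B -> B'}) :
    {linear A ⊗ B -> A' ⊗ B'} :=
  tens_lift (tens_map_bilinear f g).

Lemma tens_swap_bilinear A B : bilinear_map (fun (a : A) (b : B) => tens b a).
Proof. by have [hl hr] := tens_bilinear B A. Qed.

Definition tens_swap A B : {linear A ⊗ B -> B ⊗ A} :=
  tens_lift (@tens_swap_bilinear A B).

Lemma tens_assoc1_bilinear A B C (c : C) :
  bilinear_map (fun (a : A) (b : B) => tens a (tens b c)).
Proof.
have [hl hr] := tens_bilinear A (B ⊗ C); have [gl _] := tens_bilinear B C.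
split=> [b|a x b b'] /=; [exact: hl | by rewrite gl; exact: hr].
Qed.

Lemma tens_assoc_bilinear A B C :
  bilinear_map (fun (t : A ⊗ B) (c : C) =>
    tens_lift (@tens_assoc1_bilinear A B C c) t).
Proof.
split=> [c|v a c c']; first by move=> a u v; rewrite linearP.
have [_ hr] := tens_bilinear A (B ⊗ C); have [_ gr] := tens_bilinear B C.
have [s ->] := tens_sum v.
have E c0 : tens_lift (@tens_assoc1_bilinear A B C c0)
    (\sum_(x <- s) tens x.1 x.2) = \sum_(x <- s) tens x.1 (tens x.2 c0).
  by rewrite raddf_sum; apply: eq_bigr => y _; exact: tens_liftE.
rewrite !E scaler_sumr -big_split.
by apply: eq_bigr => y _; rewrite gr hr.
Qed.

Definition tens_assoc A B C : {linear (A ⊗ B) ⊗ C -> A ⊗ (B ⊗ C)} :=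
  tens_lift (@tens_assoc_bilinear A B C).

Lemma tens_unitl_bilinear M : bilinear_map (fun (c : k^o) (m : M) => c *: m).
Proof.
split=> [m a c c'|c a m m'] /=; first by rewrite scalerDl scalerA.
by rewrite scalerDr !scalerA mulrC.
Qed.

Definition tens_unitl M : {linear k^o ⊗ M -> M} :=
  tens_lift (@tens_unitl_bilinear M).

Lemma tens_unitr_bilinear M : bilinear_map (fun (m : M) (c : k^o) => c *: m).
Proof. by have [hl hr] := @tens_unitl_bilinear M. Qed.

Definition tens_unitr M : {linear M ⊗ k^o -> M} :=
  tens_lift (@tens_unitr_bilinear M).

End TensorFunctoriality.

Arguments tens_swap {k A B}.
Arguments tens_assoc {k A B C}.
Arguments tens_unitl {k M}.
Arguments tens_unitr {k M}.

Notation "f ⊗₁ g" := (tens_map f g) (at level 40, left associativity) : ring_scope.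

(* [Delta p q i n _] is the map written Delta_(p,q,i), from the component of
   arity n = p + q - 1; the arity is an argument tied to p and q by an equation
   so that no transport is needed in the axioms. The position [i] is 1-based;
   the values for [p > 0] and [i] outside [1, p] are unconstrained and never
   used. The three cases of coassociativity are both sides of an equation in
   C p ⊗ (C q ⊗ C r). *)
Record planar_counital_cooperad (k : comPzRingType) := PlanarCounitalCooperad {
  cooperad_mod :> nat -> lmodType k;
  counit : {linear cooperad_mod 1 -> k^o};
  Delta : forall p q i n : nat, n.+1 = (p + q)%N ->
    {linear cooperad_mod n -> cooperad_mod p ⊗ cooperad_mod q};
  Delta0 : forall q i n (e : n.+1 = (0 + q)%N) x, @Delta 0 q i n e x = 0;
  counitl : forall n (e : n.+1 = (1 + n)%N),
    tens_unitl \o (counit ⊗₁ idfun) \o @Delta 1 n 1 n e =1 id;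
  counitr : forall n i (e : n.+1 = (n + 1)%N), (1 <= i <= n)%N ->
    tens_unitr \o (idfun ⊗₁ counit) \o @Delta n 1 i n e =1 id;
  coassoc_left : forall p q r i j a b n
    (ea : a.+1 = (p + q)%N) (ear : n.+1 = (a + r)%N)
    (eb : b.+1 = (p + r)%N) (ebq : n.+1 = (b + q)%N),
    (1 <= i <= p)%N -> (1 <= j <= a)%N -> (i + q <= j)%N ->
    tens_assoc \o (@Delta p q i a ea ⊗₁ idfun) \o @Delta a r j n ear
    =1 (idfun ⊗₁ tens_swap) \o tens_assoc
         \o (@Delta p r (j - q + 1) b eb ⊗₁ idfun) \o @Delta b q i n ebq;
  coassoc_nested : forall p q r i j a b n
    (ea : a.+1 = (p + q)%N) (ear : n.+1 = (a + r)%N)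
    (eb : b.+1 = (q + r)%N) (epb : n.+1 = (p + b)%N),
    (1 <= i <= p)%N -> (1 <= j <= a)%N -> (i <= j < i + q)%N ->
    tens_assoc \o (@Delta p q i a ea ⊗₁ idfun) \o @Delta a r j n ear
    =1 (idfun ⊗₁ @Delta q r (j - i + 1) b eb) \o @Delta p b i n epb;
  coassoc_right : forall p q r i j a b n
    (ea : a.+1 = (p + q)%N) (ear : n.+1 = (a + r)%N)
    (eb : b.+1 = (p + r)%N) (ebq : n.+1 = (b + q)%N),
    (1 <= i <= p)%N -> (1 <= j <= a)%N -> (j < i)%N ->
    tens_assoc \o (@Delta p q i a ea ⊗₁ idfun) \o @Delta a r j n ear
    =1 (idfun ⊗₁ tens_swap) \o tens_assoc
         \o (@Delta p r j b eb ⊗₁ idfun) \o @Delta b q (i + r - 1) n ebq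
}.

Arguments counit {k} C : rename.
Arguments Delta {k} C p q i n e : rename.

Record cooperad_with_comult (k : comPzRingType) := CooperadWithComult {
  cooperad_of :> planar_counital_cooperad k;
  muc : {linear cooperad_of 2 -> k^o};
  ec : {linear cooperad_of 0 -> k^o};
  muc_coassoc :
    tens_unitl \o (muc ⊗₁ muc) \o Delta cooperad_of 2 2 1 3 erefl
    =1 tens_unitl \o (muc ⊗₁ muc) \o Delta cooperad_of 2 2 2 3 erefl;
  muc_ec1 : tens_unitl \o (muc ⊗₁ ec) \o Delta cooperad_of 2 0 1 1 erefl
    =1 counit cooperad_of;
  muc_ec2 : tens_unitl \o (muc ⊗₁ ec) \o Delta cooperad_of 2 0 2 1 erefl
    =1 counit cooperad_of
}.

Arguments muc {k} C : rename.
Arguments ec {k} C : rename.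

(* [d n i] is the i-th face from degree n + 1 to degree n, meaningful for
   i <= n + 1, and [s n i] the i-th degeneracy out of degree n, meaningful for
   i <= n; nothing is required of the other indices. *)
Record is_simplicial_module (k : comPzRingType) (X : nat -> lmodType k)
    (d : forall n : nat, nat -> {linear X n.+1 -> X n})
    (s : forall n : nat, nat -> {linear X n -> X n.+1}) : Prop := {
  face_face : forall n i j, (i < j <= n.+2)%N ->
    d n i \o d n.+1 j =1 d n j.-1 \o d n.+1 i;
  degen_degen : forall n i j, (i <= j <= n)%N ->
    s n.+1 i \o s n j =1 s n.+1 j.+1 \o s n i;
  face_degen_lt : forall n i j, (i < j <= n.+1)%N ->
    d n.+1 i \o s n.+1 j =1 s n j.-1 \o d n i;
  face_degen_eq : forall n j, (j <= n)%N -> d n j \o s n j =1 id;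
  face_degen_succ : forall n j, (j <= n)%N -> d n j.+1 \o s n j =1 id;
  face_degen_gt : forall n i j, (j.+1 < i <= n.+2)%N ->
    d n.+1 i \o s n.+1 j =1 s n j \o d n i.-1
}.

Section AlternatingSum.
Variables (k : comPzRingType) (X : nat -> lmodType k).
Variable d : forall n : nat, nat -> {linear X n.+1 -> X n}.

Definition alternating_sum_fun n (x : X n.+1) : X n :=
  \sum_(i < n.+2) (-1) ^+ i *: d n i x.

Lemma alternating_sum_linear n : linear (@alternating_sum_fun n).
Proof.
move=> a x y; rewrite scaler_sumr -big_split; apply: eq_bigr => i _ /=.
by rewrite linearP scalerDr !scalerA mulrC.
Qed.

Definition alternating_sum n : {linear X n.+1 -> X n} :=
  HB.pack_for {linear X n.+1 -> X n} (@alternating_sum_fun n)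
    (GRing.isLinear.Build _ _ _ _ _ (@alternating_sum_linear n)).

End AlternatingSum.

Section CooperadSimplicial.
Variables (k : comPzRingType) (C : cooperad_with_comult k).

Definition face_first n : {linear C n.+1 -> C n} :=
  tens_unitl \o (muc C ⊗₁ idfun) \o Delta C 2 n 2 n.+1 erefl.

Definition face_mid n i : {linear C n.+1 -> C n} :=
  tens_unitr \o (idfun ⊗₁ muc C) \o Delta C n 2 i n.+1 (esym (addn2 n)).

Definition face_last n : {linear C n.+1 -> C n} :=
  tens_unitl \o (muc C ⊗₁ idfun) \o Delta C 2 n 1 n.+1 erefl.

Definition cooperad_face n i : {linear C n.+1 -> C n} :=
  if i == 0%N then face_first n
  else if (i <= n)%N then face_mid n i
  else face_last n.

Definition cooperad_degen n i : {linear C n -> C n.+1} :=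
  tens_unitr \o (idfun ⊗₁ ec C) \o Delta C n.+1 0 i.+1 n (esym (addn0 n.+1)).

End CooperadSimplicial.

(* Main.v *)
Require Import Defs.
From mathcomp Require Import all_boot all_algebra.
From mathcomp Require Import zify.

(** Contracting one tensor factor of [Delta_(p,q,i)] with a functional gives
    linear maps [C n -> C q] and [C n -> C p], and every face and degeneracy is
    such a contraction with [muc] or [ec]. Contracting two of the three tensor
    factors of the coassociativity relations then yields commutation rules
    between these maps. Most simplicial identities are instances of one rule;
    the remaining ones reduce to two contractions of the same component with
    the two composites [(muc ⊗ muc) Delta_(2,2,i)] or with
    [(muc ⊗ ec) Delta_(2,0,i)], which the axioms on [muc] and [ec] identify. *)

Import GRing.Theory.
Local Open Scope ring_scope.

(** * Contraction of tensor factors with functionals *)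

Section Contraction.
Local Set Implicit Arguments.
Local Unset Strict Implicit.
Context {k : comPzRingType}.
Implicit Types A B M N P Q R : lmodType k.

(** Scalars are absorbed into pure tensors, so closure under sums suffices. *)
Lemma tensor_ind M N (T : M ⊗ N -> Prop) :
  T 0 -> (forall u v, T u -> T v -> T (u + v)) ->
  (forall m n, T (tens m n)) -> forall v, T v.
Proof.
move=> T0 TD Tt v; have [s ->] := tens_sum v.
by elim: s => [|x s IHs]; rewrite ?big_nil ?big_cons //; apply: TD.
Qed.

Lemma tens_mapE A M B N (f : {linear A -> M}) (g : {linear B -> N}) a b :
  (f ⊗₁ g) (tens a b) = tens (f a) (g b).
Proof. exact: tens_liftE. Qed.

Lemma tens_swapE A B (a : A) (b : B) : tens_swap (tens a b) = tens b a.
Proof. exact: tens_liftE. Qed.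

Lemma tens_assocE A B M (a : A) (b : B) (m : M) :
  tens_assoc (tens (tens a b) m) = tens a (tens b m).
Proof. by rewrite /tens_assoc !tens_liftE. Qed.

Lemma tensDl A B (a a' : A) (b : B) : tens (a + a') b = tens a b + tens a' b.
Proof.
by have := (tens_bilinear A B).1 b 1 a a'; rewrite /= !scale1r.
Qed.

Lemma tens0l A B (b : B) : tens (0 : A) b = 0.
Proof. by apply: (addrI (tens 0 b)); rewrite -tensDl !addr0. Qed.

Definition contractl {A B} (f : {linear A -> k^o}) : {linear A ⊗ B -> B} :=
  tens_unitl \o (f ⊗₁ idfun).

Definition contractr {A B} (f : {linear B -> k^o}) : {linear A ⊗ B -> A} :=
  tens_unitr \o (idfun ⊗₁ f).

Definition pairing {A B} (f : {linear A -> k^o}) (g : {linear B -> k^o}) :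
    {linear A ⊗ B -> k^o} :=
  tens_unitl \o (f ⊗₁ g).

Lemma contractlE A B (f : {linear A -> k^o}) (a : A) (b : B) :
  contractl f (tens a b) = f a *: b.
Proof.
rewrite -[LHS]/(tens_unitl ((f ⊗₁ idfun) (tens a b))) tens_mapE.
exact: tens_liftE.
Qed.

Lemma contractrE A B (f : {linear B -> k^o}) (a : A) (b : B) :
  contractr f (tens a b) = f b *: a.
Proof.
rewrite -[LHS]/(tens_unitr ((idfun ⊗₁ f) (tens a b))) tens_mapE.
exact: tens_liftE.
Qed.

Lemma pairingE A B (f : {linear A -> k^o}) (g : {linear B -> k^o}) a b :
  pairing f g (tens a b) = f a * g b.
Proof.
rewrite -[LHS]/(tens_unitl ((f ⊗₁ g) (tens a b))) tens_mapE.
exact: tens_liftE.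
Qed.

Let contractE := (contractlE, contractrE, pairingE, tens_mapE, tens_assocE,
  tens_swapE).

Lemma contractl_ext A B (f g : {linear A -> k^o}) :
  f =1 g -> @contractl A B f =1 contractl g.
Proof. by move=> fg; apply: tens_ext => a b; rewrite !contractE fg. Qed.

Lemma contractr_ext A B (f g : {linear B -> k^o}) :
  f =1 g -> @contractr A B f =1 contractr g.
Proof. by move=> fg; apply: tens_ext => a b; rewrite !contractE fg. Qed.

(** Both sides are linear, so they are compared on pure tensors [a ⊗ r], and then on the pure
    tensors in an expansion of [D a], where the associator can be computed. This lemma and the next
    two leave [P], [Q] and [R] respectively as the surviving factor of [P ⊗ (Q ⊗ R)]. *)
Lemma contractr_contractr A P Q R (D : {linear A -> P ⊗ Q})
    (g : {linear Q -> k^o}) (h : {linear R -> k^o}) v :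
  contractr g (D (contractr h v)) =
  contractr (pairing g h) (tens_assoc ((D ⊗₁ idfun) v)).
Proof.
elim/tensor_ind: v => [|u v IHu IHv|a r]; first by rewrite !linear0.
  by rewrite !linearD IHu IHv.
rewrite !contractE !linearZ_LR.
elim/tensor_ind: (D a) => [|u v IHu IHv|p q].
- by rewrite tens0l !linear0.
- by rewrite (linearD (contractr g)) scalerDr IHu IHv tensDl !linearD.
- by rewrite !contractE scalerA mulrC.
Qed.

Lemma contractl_contractr A P Q R (D : {linear A -> P ⊗ Q})
    (f : {linear P -> k^o}) (h : {linear R -> k^o}) v :
  contractl f (D (contractr h v)) =
  contractr h (contractl f (tens_assoc ((D ⊗₁ idfun) v))).
Proof.
elim/tensor_ind: v => [|u v IHu IHv|a r]; first by rewrite !linear0.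
  by rewrite !linearD IHu IHv.
rewrite !contractE !linearZ_LR.
elim/tensor_ind: (D a) => [|u v IHu IHv|p q].
- by rewrite tens0l !linear0.
- by rewrite (linearD (contractl f)) scalerDr IHu IHv tensDl !linearD.
- by rewrite !contractE (linearZ_LR (contractr h)) contractE !scalerA mulrC.
Qed.

Lemma contractl_pairing A P Q R (D : {linear A -> P ⊗ Q})
    (f : {linear P -> k^o}) (g : {linear Q -> k^o}) (v : A ⊗ R) :
  contractl (pairing f g \o D) v =
  contractl g (contractl f (tens_assoc ((D ⊗₁ idfun) v))).
Proof.
elim/tensor_ind: v => [|u v IHu IHv|a r]; first by rewrite !linear0.
  by rewrite !linearD IHu IHv.
(* The composite functional is unfolded to expose [D a] for the second induction. *)
rewrite contractlE [in RHS]tens_mapE -[X in X *: r = _]/(pairing f g (D a)).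
elim/tensor_ind: (D a) => [|u v IHu IHv|p q].
- by rewrite tens0l !linear0 scale0r.
- by rewrite tensDl !linearD scalerDl IHu IHv.
- by rewrite !contractE (linearZ_LR (contractl g)) contractE scalerA.
Qed.

Lemma contractr_pairing_map P Q R B (D : {linear B -> Q ⊗ R})
    (g : {linear Q -> k^o}) (h : {linear R -> k^o}) (v : P ⊗ B) :
  contractr (pairing g h) ((idfun ⊗₁ D) v) =
  contractr (pairing g h \o D) v.
Proof.
elim/tensor_ind: v => [|u v IHu IHv|a r]; first by rewrite !linear0.
  by rewrite !linearD IHu IHv.
by rewrite !contractE.
Qed.

Lemma contractl_map P B M (D : {linear B -> M}) (f : {linear P -> k^o}) (v : P ⊗ B) :
  contractl f ((idfun ⊗₁ D) v) = D (contractl f v).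
Proof.
elim/tensor_ind: v => [|u v IHu IHv|a r]; first by rewrite !linear0.
  by rewrite !linearD IHu IHv.
by rewrite !contractE linearZ_LR.
Qed.

Lemma pairing_swap Q R (g : {linear Q -> k^o}) (h : {linear R -> k^o}) (v : Q ⊗ R) :
  pairing h g (tens_swap v) = pairing g h v.
Proof.
elim/tensor_ind: v => [|u v IHu IHv|a r]; first by rewrite !linear0.
  by rewrite !linearD IHu IHv.
by rewrite !contractE mulrC.
Qed.

Lemma contractr_pairing_swap P Q R (g : {linear Q -> k^o})
    (h : {linear R -> k^o}) (v : P ⊗ (Q ⊗ R)) :
  contractr (pairing h g) ((idfun ⊗₁ tens_swap) v) =
  contractr (pairing g h) v.
Proof.
by rewrite contractr_pairing_map; apply: contractr_ext => w; exact: pairing_swap.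
Qed.

Lemma contractl_swap Q R (f : {linear Q -> k^o}) (v : R ⊗ Q) :
  contractl f (tens_swap v) = contractr f v.
Proof.
elim/tensor_ind: v => [|u v IHu IHv|a r]; first by rewrite !linear0.
  by rewrite !linearD IHu IHv.
by rewrite !contractE.
Qed.

Lemma contractr_swap Q R (f : {linear R -> k^o}) (v : R ⊗ Q) :
  contractr f (tens_swap v) = contractl f v.
Proof.
elim/tensor_ind: v => [|u v IHu IHv|a r]; first by rewrite !linear0.
  by rewrite !linearD IHu IHv.
by rewrite !contractE.
Qed.

End Contraction.

(** * Contracted cocompositions and their commutation rules *)

Section PartialCocomposition.
Context {k : comPzRingType} {C : planar_counital_cooperad k}.

Definition cocompl p q i n (e : n.+1 = (p + q)%N) (f : {linear C p -> k^o}) :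
    {linear C n -> C q} :=
  contractl f \o Delta C p q i n e.

Definition cocompr p q i n (e : n.+1 = (p + q)%N) (f : {linear C q -> k^o}) :
    {linear C n -> C p} :=
  contractr f \o Delta C p q i n e.

Definition cocomp p q i n (e : n.+1 = (p + q)%N) (f : {linear C p -> k^o})
    (g : {linear C q -> k^o}) : {linear C n -> k^o} :=
  pairing f g \o Delta C p q i n e.

Local Set Implicit Arguments.
Local Unset Strict Implicit.

Lemma cocomplE p q i n e f x :
  cocompl p q i n e f x = contractl f (Delta C p q i n e x).
Proof. by []. Qed.

Lemma cocomprE p q i n e f x :
  cocompr p q i n e f x = contractr f (Delta C p q i n e x).
Proof. by []. Qed.

(** Equality proofs on natural numbers are irrelevant, so the arity equation may change along with
    the functional. *)
Lemma cocompl_ext p q i n (e e' : n.+1 = (p + q)%N)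
    (f g : {linear C p -> k^o}) :
  f =1 g -> cocompl p q i n e f =1 cocompl p q i n e' g.
Proof.
by move=> fg x; rewrite (eq_irrelevance e e'); exact: (contractl_ext fg).
Qed.

Lemma cocompr_ext p q i n (e e' : n.+1 = (p + q)%N)
    (f g : {linear C q -> k^o}) :
  f =1 g -> cocompr p q i n e f =1 cocompr p q i n e' g.
Proof.
by move=> fg x; rewrite (eq_irrelevance e e'); exact: (contractr_ext fg).
Qed.

Lemma cocompl_counit n e (f : {linear C 1 -> k^o}) :
  f =1 counit C -> cocompl 1 n 1 n e f =1 id.
Proof.
by move=> fe x; rewrite (cocompl_ext _ e e fe); exact: counitl.
Qed.

Lemma cocompr_counit n i e (f : {linear C 1 -> k^o}) :
  f =1 counit C -> (1 <= i <= n)%N -> cocompr n 1 i n e f =1 id.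
Proof.
by move=> fe hi x; rewrite (cocompr_ext _ e e fe); exact: counitr.
Qed.

(** * Coassociativity at two distinct inputs *)

Section Parallel.
Variables (p q r i j l a b n : nat).
Variables (ea : a.+1 = (p + q)%N) (ear : n.+1 = (a + r)%N).
Variables (eb : b.+1 = (p + r)%N) (ebq : n.+1 = (b + q)%N).
Hypotheses (hi : (1 <= i <= p)%N) (hj : (1 <= j <= a)%N) (hij : (i + q <= j)%N).
Hypothesis hl : l = (j - q + 1)%N.

(** The position [l] is tied to its value by an equation, so that it can be matched in whatever form
    a goal presents it and the equation left to arithmetic. *)
Let coassoc x :
  tens_assoc ((Delta C p q i a ea ⊗₁ idfun) (Delta C a r j n ear x)) =
  (idfun ⊗₁ tens_swap)
    (tens_assoc ((Delta C p r l b eb ⊗₁ idfun) (Delta C b q i n ebq x))).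
Proof. by rewrite hl; exact: coassoc_left. Qed.

(** The swap in coassociativity only exchanges the two functionals. The surviving factor is [C p]
    here, [C r] and [C q] in the next two rules. *)
Lemma cocompr_cocompr_parallel f g x :
  cocompr p q i a ea f (cocompr a r j n ear g x) =
  cocompr p r l b eb g (cocompr b q i n ebq f x).
Proof.
by rewrite !cocomprE !contractr_contractr coassoc contractr_pairing_swap.
Qed.

Lemma cocompl_cocomp_parallel f g x :
  cocompl a r j n ear (cocomp p q i a ea f g) x =
  cocompl p r l b eb f (cocompr b q i n ebq g x).
Proof.
by rewrite !(cocomplE, cocomprE) contractl_pairing contractl_contractr coassoc
  contractl_map contractl_swap.
Qed.

Lemma cocompl_cocompr_parallel f g x :
  cocompl p q i a ea f (cocompr a r j n ear g x) =
  cocompl b q i n ebq (cocomp p r l b eb f g) x.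
Proof.
by rewrite !(cocomplE, cocomprE) contractl_pairing contractl_contractr coassoc
  contractl_map contractr_swap.
Qed.

End Parallel.

(** * Coassociativity for nested insertions *)

Section Nested.
Variables (p q r i j l a b n : nat).
Variables (ea : a.+1 = (p + q)%N) (ear : n.+1 = (a + r)%N).
Variables (eb : b.+1 = (q + r)%N) (epb : n.+1 = (p + b)%N).
Hypotheses (hi : (1 <= i <= p)%N) (hj : (1 <= j <= a)%N) (hij : (i <= j < i + q)%N).
Hypothesis hl : l = (j - i + 1)%N.

Let coassoc x :
  tens_assoc ((Delta C p q i a ea ⊗₁ idfun) (Delta C a r j n ear x)) =
  (idfun ⊗₁ Delta C q r l b eb) (Delta C p b i n epb x).
Proof. by rewrite hl; exact: coassoc_nested. Qed.

(** The surviving factor is [C p] here, [C q] and [C r] in the next two rules. *)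
Lemma cocompr_cocompr_nested f g x :
  cocompr p q i a ea f (cocompr a r j n ear g x) =
  cocompr p b i n epb (cocomp q r l b eb f g) x.
Proof.
by rewrite !cocomprE contractr_contractr coassoc contractr_pairing_map.
Qed.

Lemma cocompl_cocompr_nested f g x :
  cocompl p q i a ea f (cocompr a r j n ear g x) =
  cocompr q r l b eb g (cocompl p b i n epb f x).
Proof.
by rewrite !(cocomplE, cocomprE) contractl_contractr coassoc contractl_map.
Qed.

Lemma cocompl_cocomp_nested f g x :
  cocompl a r j n ear (cocomp p q i a ea f g) x =
  cocompl q r l b eb g (cocompl p b i n epb f x).
Proof.
by rewrite !cocomplE contractl_pairing coassoc contractl_map.
Qed.

End Nested.
End PartialCocomposition.

(** * Cancellation in a double sum *)

Section AlternatingDoubleSum.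
Variable V : zmodType.

(** The entries with [i < j] cancel against the others through [(i, j) -> (j - 1, i)]. In the
    induction, the new column [F i N.+1] cancels against the new row [F N i]. *)
Lemma alternating_double_sum_eq0 N (F : nat -> nat -> V) :
  (forall i j, (i < j <= N)%N -> F i j = - F j.-1 i) ->
  \sum_(i < N) \sum_(j < N.+1) F i j = 0.
Proof.
elim: N => [|N IHN] FN; first by rewrite big_ord0.
rewrite big_ord_recr /=.
under eq_bigr => i _ do rewrite big_ord_recr /=.
rewrite big_split /= IHN ?add0r; last first.
  by move=> i j /andP[ij jN]; apply: FN; rewrite ij ltnW.
(* The corner [F N N.+1] is [- F N N] and cancels the diagonal entry of the new row. *)
rewrite [in X in _ + X]big_ord_recr /= (FN N N.+1) ?ltnSn //=.
rewrite [in X in _ + (X - _)]big_ord_recr /= addrK -big_split big1 // => i _ /=.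
by rewrite (FN i N.+1) ?addNr // leqnn andbT ltnS ltnW.
Qed.

End AlternatingDoubleSum.

(** * The simplicial identities *)

Section Simplicial.
Variables (k : comPzRingType) (C : cooperad_with_comult k).
Local Notation mu := (muc C).
Local Notation eta := (ec C).
Local Notation d := (cooperad_face C).
Local Notation s := (cooperad_degen C).

Lemma face_firstE n x : d n 0 x = cocompl 2 n 2 n.+1 erefl mu x.
Proof. by []. Qed.

Lemma face_midE n i x :
  (1 <= i <= n)%N -> d n i x = cocompr n 2 i n.+1 (esym (addn2 n)) mu x.
Proof. by case: i => [//|i] /= i_n; rewrite /cooperad_face /= i_n. Qed.

Lemma face_lastE n i x : (n < i)%N -> d n i x = cocompl 2 n 1 n.+1 erefl mu x.
Proof. by case: i => [//|i] n_i; rewrite /cooperad_face /= leqNgt n_i. Qed.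

Lemma degenE n i x :
  s n i x = cocompr n.+1 0 i.+1 n (esym (addn0 n.+1)) eta x.
Proof. by []. Qed.

Lemma muc_coassocE (e e' : 4 = (2 + 2)%N) :
  cocomp 2 2 1 3 e mu mu =1 cocomp 2 2 2 3 e' mu mu.
Proof.
by rewrite (eq_irrelevance e erefl) (eq_irrelevance e' erefl); exact: muc_coassoc.
Qed.

Lemma muc_ecE i (e : 2 = (2 + 0)%N) :
  (1 <= i <= 2)%N -> cocomp 2 0 i 1 e mu eta =1 counit C.
Proof.
rewrite (eq_irrelevance e erefl).
by case: i => [|[|[|i]]] // _; [exact: muc_ec1|exact: muc_ec2].
Qed.

(** When the two copies of [mu] do not meet, a commutation rule applies. When they meet, both sides
    contract one component having a factor [C 3] with the two composites of [mu]. *)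
Lemma cooperad_face_face n i j x :
  (i < j <= n.+2)%N -> d n i (d n.+1 j x) = d n j.-1 (d n.+1 i x).
Proof.
move=> /andP[ij jn]; have e4 : 4 = (2 + 2)%N by [].
have e3 : n.+3 = (3 + n)%N by [].
have e3' : n.+3 = (n + 3)%N by rewrite addn3.
have [i0|i0] := posnP i; have [jn1|jn1] := leqP j n.+1.
- rewrite i0 !face_firstE (face_midE n.+1 j) ?jn1 ?(leq_trans _ ij) //.
  have [j1|j1] := leqP j 1.
    have -> : j = 1%N by lia.
    rewrite face_firstE.
    (* Both sides become contractions of [Delta C 3 n 3]: the surviving factor sits at the last of
       three inputs. *)
    rewrite -(cocompl_cocomp_parallel (j := 3) e4 e3) //.
    rewrite -(cocompl_cocomp_nested (j := 3) e4 e3) //.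
    exact/cocompl_ext/muc_coassocE.
  rewrite face_midE; last lia.
  apply: cocompl_cocompr_nested; lia.
- rewrite i0 !face_firstE !face_lastE //; last lia.
  (* The two outer faces: the surviving factor sits at the middle input. *)
  rewrite -!(cocompl_cocomp_nested (j := 2) e4 e3) //.
  exact/cocompl_ext/muc_coassocE.
- rewrite !face_midE; try lia.
  have [ij1|ij1] := leqP i.+2 j.
    apply: cocompr_cocompr_parallel; lia.
  have -> : j = i.+1 by lia.
  (* Adjacent inner faces: both sides contract the factor [C 3] of [Delta C n 3 i]. *)
  rewrite (cocompr_cocompr_nested (l := 2) _ _ e4 e3'); try lia.
  rewrite (cocompr_cocompr_nested (l := 1) _ _ e4 e3'); try lia.
  by apply: cocompr_ext => y; rewrite muc_coassocE.
- rewrite (face_lastE n.+1 j) // (face_lastE n j.-1); last lia.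
  rewrite (face_midE n.+1 i); last lia.
  have [i_n|i_n] := leqP i n.
    rewrite face_midE ?i0 //; apply/esym.
    apply: cocompl_cocompr_nested; lia.
  rewrite face_lastE //.
  (* Here [i = n + 1], and the surviving factor sits at the first input. *)
  rewrite (cocompl_cocompr_parallel (l := 2) _ _ e4 e3); try lia.
  rewrite -(cocompl_cocomp_nested (j := 1) e4 e3) //.
  exact/cocompl_ext/muc_coassocE.
Qed.

(** With [q = 0] the parallel condition [i + q <= j] also covers [i = j], and the shifted position
    [j - q + 1] accounts for the index [j.+1]. *)
Lemma cooperad_degen_degen n i j x :
  (i <= j <= n)%N -> s n.+1 i (s n j x) = s n.+1 j.+1 (s n i x).
Proof. by move=> ij; rewrite !degenE; apply: cocompr_cocompr_parallel; lia. Qed.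

Lemma cooperad_face_degen_lt n i j x :
  (i < j <= n.+1)%N -> d n.+1 i (s n.+1 j x) = s n j.-1 (d n i x).
Proof.
move=> ij; rewrite !degenE; have [i0|i0] := posnP i.
  by rewrite i0 !face_firstE; apply: cocompl_cocompr_nested; lia.
by rewrite !face_midE; try lia; apply: cocompr_cocompr_parallel; lia.
Qed.

Lemma cooperad_face_degen_gt n i j x :
  (j.+1 < i <= n.+2)%N -> d n.+1 i (s n.+1 j x) = s n j (d n i.-1 x).
Proof.
move=> ij; rewrite !degenE; have [i_n|i_n] := leqP i n.+1.
  rewrite !face_midE; try lia.
  (* The degeneracy now has the smaller position, so the rule is read from right to left. *)
  by apply/esym/cocompr_cocompr_parallel; lia.
by rewrite !face_lastE; try lia; apply: cocompl_cocompr_nested; lia.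
Qed.

(** The contraction with [eta] falls on an input of [mu]; the composite functional on [C 1] is the
    counit, and the counit axioms conclude. *)
Lemma cooperad_face_degen_id n i j x :
  (j <= n)%N -> (j <= i <= j.+1)%N -> d n i (s n j x) = x.
Proof.
move=> jn ij; rewrite degenE.
have e2 : 2 = (2 + 0)%N by []; have e1 : n.+1 = (1 + n)%N by [].
have e1' : n.+1 = (n + 1)%N by rewrite addn1.
have [i0|i0] := posnP i; last have [i_n|i_n] := leqP i n.
- have -> : j = 0%N by lia.
  rewrite i0 face_firstE.
  rewrite -(cocompl_cocomp_parallel (i := 1) (j := 1) e2 e1) //.
  exact/cocompl_counit/muc_ecE.
- rewrite face_midE ?i0 //.
  (* The input of [mu] that meets [eta] is 2 for [i = j] and 1 for [i = j.+1]. *)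
  rewrite (cocompr_cocompr_nested (l := (j.+1 - i + 1)%N) _ _ e2 e1'); try lia.
  by apply: cocompr_counit; [apply: muc_ecE; lia|lia].
- rewrite face_lastE //.
  rewrite (cocompl_cocompr_parallel (l := 2) _ _ e2 e1); try lia.
  exact/cocompl_counit/muc_ecE.
Qed.

End Simplicial.

(** * The differential and the assembled theorem *)

Lemma alternating_sum_sq0 (k : comPzRingType) (X : nat -> lmodType k)
    (d : forall n, nat -> {linear X n.+1 -> X n}) n (x : X n.+2) :
  (forall i j, (i < j <= n.+2)%N -> d n i (d n.+1 j x) = d n j.-1 (d n.+1 i x)) ->
  alternating_sum d n (alternating_sum d n.+1 x) = 0.
Proof.
move=> dd; rewrite -[LHS]/(\sum_(i < n.+2) (-1) ^+ i *:
  d n i (\sum_(j < n.+3) (-1) ^+ j *: d n.+1 j x)).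
pose F i j := (-1) ^+ (i + j) *: d n i (d n.+1 j x).
transitivity (\sum_(i < n.+2) \sum_(j < n.+3) F i j).
  apply: eq_bigr => i _; rewrite linear_sum scaler_sumr; apply: eq_bigr => j _.
  by rewrite linearZ_LR scalerA -exprD.
apply: alternating_double_sum_eq0 => i [//|j] /= ij.
(* Passing from [(i, j)] to [(j - 1, i)] lowers the exponent of the sign by one. *)
by rewrite /F dd // addnS exprS mulN1r scaleNr addnC.
Qed.

Theorem proposition3p1 (k : comPzRingType) (C : cooperad_with_comult k) :
  is_simplicial_module (cooperad_face C) (cooperad_degen C) /\
  (forall (n : nat) (x : C n.+2),
     alternating_sum (cooperad_face C) n
       (alternating_sum (cooperad_face C) n.+1 x) = 0).
Proof.
split=> [|n x]; last first.
  by apply: alternating_sum_sq0 => i j; exact: cooperad_face_face.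
split=> [n i j ij x|n i j ij x|n i j ij x|n j jn x|n j jn x|n i j ij x].
- exact: cooperad_face_face.
- exact: cooperad_degen_degen.
- exact: cooperad_face_degen_lt.
- by apply: cooperad_face_degen_id => //; lia.
- by apply: cooperad_face_degen_id => //; lia.
- exact: cooperad_face_degen_gt.
Qed.
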